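(* Suppose $\Gamma_D=\emptyset$, and let $(\mathbf u^h,\hat{\mathbf u}^h,p^h,\hat p^h,\mathbf B^h,\hat{\mathbf B}^h,r^h,\hat r^h)$ be a solution of the semi-discrete HDG method (S1)-(S10) written out in the context. Then, for all $t\in(0,\infty)$, $$\frac{d}{dt}\sum_e\int_{\Omega_e}\rho\,\mathbf u^h=\sum_e\int_{\Omega_e}\rho\,\mathbf f_v-\sum_e\sum_i\int_{\Gamma_N\cap\Gamma_{e_i}}(1-\lambda)\rho(\hat{\mathbf u}^h\cdot\mathbf n)\hat{\mathbf u}^h+\sum_e\sum_i\int_{\Gamma_N\cap\Gamma_{e_i}}\rho\,\mathbf h_v .$$
   Context: **Conventions.** $(\mathbf a\otimes\mathbf b)_{ij}=a_ib_j$; $(\nabla\mathbf a)_{ij}=\partial a_j/\partial x_i$; $\mathbf C:\mathbf D=\sum_{i,j}C_{ij}D_{ij}$; $\nabla^s\mathbf a=\frac12(\nabla\mathbf a+(\nabla\mathbf a)^T)$; $\nabla^a\mathbf a=\frac12(\nabla\mathbf a-(\nabla\mathbf a)^T)$; $\mathbb 1$ is the $d\times d$ identity. **Data.** $\Omega\subset\mathbb R^d$, $d\in\{2,3\}$, is a bounded domain with outward unit normal $\mathbf n$; $\partial\Omega=\overline{\Gamma_D\cup\Gamma_N}$, $\Gamma_D\cap\Gamma_N=\emptyset$. $\rho,\mu_0>0$ are constants; $\nu,\eta:\Omega\times(0,\infty)\to\mathbb R^+$; $\mathbf f_v,\mathbf f_m:\Omega\times(0,\infty)\to\mathbb R^d$;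 $\mathbf g_v,\mathbf g_m:\Gamma_D\times(0,\infty)\to\mathbb R^d$; $\mathbf h_v,\mathbf h_m:\Gamma_N\times(0,\infty)\to\mathbb R^d$; $\mathbf u_0,\mathbf B_0:\Omega\to\mathbb R^d$ (all regular enough that the integrals below make sense). **Mesh and spaces.** $\mathcal T=\{\Omega_e\}$ is a finite triangulation of $\Omega$ into simplices, $\bar\Omega=\overline{\cup_e\Omega_e}$; $\Gamma_{e_i}$ is the $i$-th facet of $\Omega_e$ and $\mathbf n$ on $\Gamma_{e_i}$ is the outward unit normal to $\Omega_e$; $h_e$ is the diameter of $\Omega_e$. $\mathcal F$ is the set of all facets, $\tilde\Gamma=\overline{\cup_{F\in\mathcal F}F}$. Each interior facet (not on $\partial\Omega$) is shared by exactly two elements. With $P_k(D)$ the polynomials of degree at most $k$ on $D$ and $k\ge1$: $V^h=W^h=\{\mathbf v\in[L^2(\Omega)]^d:\mathbf v|_{\Omega_e}\in[P_k(\Omega_e)]^d\ \forall\Omega_e\in\mathcal T\}$; $\hat V^h=\hat W^h=\{\hat{\mathbf v}\in[L^2(\tilde\Gamma)]^d:\hat{\mathbf v}|_F\in[P_k(F)]^d\ \forall F\in\mathcal F\}$; $Q^h_v=Q^h_m=\{q\in L^2(\Omega):q|_{\Omega_e}\in P_{k-1}(\Omega_e)\ \forall\Omega_e\in\mathcal T\}$; $\hat Q^h_v=\hat Q^h_m=\{\hat q\in L^2(\tilde\Gamma):\hat q|_F\in P_k(F)\ \forall F\in\mathcal F\}$; $\hat V^h_0,\hat W^h_0$ are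 the subspaces of $\hat V^h,\hat W^h$ of functions vanishing on $\Gamma_D$; $\hat V^h_g(t),\hat W^h_g(t)$ are the subsets of $\hat V^h,\hat W^h$ of functions equal on $\Gamma_D$ to $\mathbf g_v(\cdot,t)$, $\mathbf g_m(\cdot,t)$ respectively. **Semi-discrete HDG method.** Find $(\mathbf u^h,\hat{\mathbf u}^h,p^h,\hat p^h,\mathbf B^h,\hat{\mathbf B}^h,r^h,\hat r^h)(t)\in V^h\times\hat V^h_g(t)\times Q^h_v\times\hat Q^h_v\times W^h\times\hat W^h_g(t)\times Q^h_m\times\hat Q^h_m$ for each $t\in[0,\infty)$, with $\mathbf u^h,\mathbf B^h$ differentiable in time, satisfying (S1)-(S10). $C_{\rm pen}>0$ is a penalty constant. On each $\Gamma_{e_i}$, $\lambda=1$ where $\mathbf u^h\cdot\mathbf n<0$ and $\lambda=0$ where $\mathbf u^h\cdot\mathbf n\ge0$ ($\mathbf u^h$ and other element fields are evaluated from inside $\Omega_e$). Write $\mathbf M(\mathbf b)=\frac1{\rho\mu_0}(\mathbf b\otimes\mathbf b-\frac12|\mathbf b|^2\mathbb 1)$. The equations, for all $t>0$ in (S1)-(S8), are: (S1) for all $\mathbf v^h\in V^h$: $\sum_e\int_{\Omega_e}\big[\partial_t\mathbf u^h\cdot\mathbf v^h-(\mathbf u^h\otimes\mathbf u^h):\nabla\mathbf v^h-\frac1\rho p^h\mathbb 1:\nabla\mathbf v^h+2\nu\nabla^s\mathbf u^h:\nabla^s\mathbf v^h+\mathbf M(\mathbf B^h):\nabla\mathbf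 v^h-\mathbf f_v\cdot\mathbf v^h\big]$ $+\sum_e\sum_i\int_{\Gamma_{e_i}}\big[(1-\lambda)(\mathbf u^h\otimes\mathbf u^h)+\lambda(\mathbf u^h\otimes\hat{\mathbf u}^h)+\frac1\rho\hat p^h\mathbb 1-2\nu\nabla^s\mathbf u^h+2\frac{C_{\rm pen}}{h_e}\nu\,\mathbf n\otimes(\mathbf u^h-\hat{\mathbf u}^h)-\mathbf M(\hat{\mathbf B}^h)\big]:(\mathbf n\otimes\mathbf v^h)$ $-\sum_e\sum_i\int_{\Gamma_{e_i}}2\nu\big(\mathbf n\otimes(\mathbf u^h-\hat{\mathbf u}^h)\big):\nabla^s\mathbf v^h=0$. (S2) for all $\hat{\mathbf v}^h\in\hat V^h_0$: $\sum_e\sum_i\int_{\Gamma_{e_i}}\big[(1-\lambda)(\mathbf u^h\otimes\mathbf u^h)+\lambda(\mathbf u^h\otimes\hat{\mathbf u}^h)+\frac1\rho\hat p^h\mathbb 1-2\nu\nabla^s\mathbf u^h+2\frac{C_{\rm pen}}{h_e}\nu\,\mathbf n\otimes(\mathbf u^h-\hat{\mathbf u}^h)-\mathbf M(\hat{\mathbf B}^h)\big]:(\mathbf n\otimes\hat{\mathbf v}^h)$ $-\sum_e\sum_i\int_{\Gamma_N\cap\Gamma_{e_i}}(1-\lambda)(\mathbf u^h\otimes\hat{\mathbf u}^h):(\mathbf n\otimes\hat{\mathbf v}^h)+\sum_e\sum_i\int_{\Gamma_N\cap\Gamma_{e_i}}\mathbf h_v\cdot\hat{\mathbf v}^h=0$.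 (S3) for all $q^h_v\in Q^h_v$: $\sum_e\int_{\Omega_e}\frac1\rho(\nabla\cdot\mathbf u^h)q^h_v=0$. (S4) for all $\hat q^h_v\in\hat Q^h_v$: $\sum_e\sum_i\int_{\Gamma_{e_i}}\frac1\rho(\mathbf u^h-\hat{\mathbf u}^h)\cdot\mathbf n\,\hat q^h_v=0$. (S5) for all $\mathbf w^h\in W^h$: $\sum_e\int_{\Omega_e}\big[\partial_t\mathbf B^h\cdot\mathbf w^h-(\mathbf u^h\otimes\mathbf B^h):\nabla\mathbf w^h-r^h\mathbb 1:\nabla\mathbf w^h+2\frac{\eta}{\mu_0}\nabla^a\mathbf B^h:\nabla^a\mathbf w^h-(\mathbf B^h\otimes\mathbf w^h):\nabla\mathbf u^h-\mathbf f_m\cdot\mathbf w^h\big]$ $+\sum_e\sum_i\int_{\Gamma_{e_i}}\big[(1-\lambda)(\mathbf u^h\otimes\mathbf B^h)+\lambda(\mathbf u^h\otimes\hat{\mathbf B}^h)+\hat r^h\mathbb 1-2\frac{\eta}{\mu_0}\nabla^a\mathbf B^h+2\frac{\eta}{\mu_0}\frac{C_{\rm pen}}{h_e}\mathbf n\otimes(\mathbf B^h-\hat{\mathbf B}^h)\big]:(\mathbf n\otimes\mathbf w^h)$ $-\sum_e\sum_i\int_{\Gamma_{e_i}}2\frac{\eta}{\mu_0}\big(\mathbf n\otimes(\mathbf B^h-\hat{\mathbf B}^h)\big):\nabla^a\mathbf w^h=0$. (S6) for all $\hat{\mathbf w}^h\in\hat W^h_0$: $\sum_e\sum_i\int_{\Gamma_{e_i}}\big[(1-\lambda)(\mathbf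 u^h\otimes\mathbf B^h)+\lambda(\mathbf u^h\otimes\hat{\mathbf B}^h)+\hat r^h\mathbb 1-2\frac{\eta}{\mu_0}\nabla^a\mathbf B^h+2\frac{\eta}{\mu_0}\frac{C_{\rm pen}}{h_e}\mathbf n\otimes(\mathbf B^h-\hat{\mathbf B}^h)\big]:(\mathbf n\otimes\hat{\mathbf w}^h)$ $-\sum_e\sum_i\int_{\Gamma_{e_i}}\big(\hat{\mathbf B}^h\otimes\hat{\mathbf w}^h-\frac12(\hat{\mathbf B}^h\cdot\hat{\mathbf w}^h)\mathbb 1\big):\big(\mathbf n\otimes(\mathbf u^h-\hat{\mathbf u}^h)\big)$ $-\sum_e\sum_i\int_{\Gamma_N\cap\Gamma_{e_i}}(1-\lambda)(\mathbf u^h\otimes\hat{\mathbf B}^h):(\mathbf n\otimes\hat{\mathbf w}^h)+\sum_e\sum_i\int_{\Gamma_N\cap\Gamma_{e_i}}\mathbf h_m\cdot\hat{\mathbf w}^h=0$. (S7) for all $q^h_m\in Q^h_m$: $\sum_e\int_{\Omega_e}q^h_m\nabla\cdot\mathbf B^h=0$. (S8) for all $\hat q^h_m\in\hat Q^h_m$: $\sum_e\sum_i\int_{\Gamma_{e_i}}(\mathbf B^h-\hat{\mathbf B}^h)\cdot\mathbf n\,\hat q^h_m=0$. (S9) for all $\mathbf v^h\in V^h$: $\sum_e\int_{\Omega_e}(\mathbf u^h(\cdot,0)-\mathbf u_0)\cdot\mathbf v^h=0$. (S10) for all $\mathbf w^h\in W^h$: $\sum_e\int_{\Omega_e}(\mathbf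 B^h(\cdot,0)-\mathbf B_0)\cdot\mathbf w^h=0$. *)

(* Defs.v *)
From HB Require Import structures.
From mathcomp Require Import all_boot all_order all_algebra.
From mathcomp Require Import all_classical all_reals all_analysis.
Set Implicit Arguments. Unset Strict Implicit. Unset Printing Implicit Defensive.
Import Order.TTheory GRing.Theory Num.Theory.
Import numFieldNormedType.Exports.
Local Open Scope classical_set_scope.
Local Open Scope ring_scope.
Notation tup R n := (n.-tuple (measurableTypeR R)).

Definition tcons (R : realType) (n : nat)
  (p : measurableTypeR R * tup R n) : tup R n.+1 := [tuple of p.1 :: p.2].

(* Lebesgue measure on R^n, as the n-fold product of the one on R. *)
Fixpoint leb (R : realType) (n : nat) : set (tup R n) -> \bar R :=
  match n with
  | 0 => \d_ ([tuple] : tup R 0)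
  | m.+1 => pushforward (lebesgue_measure \x @leb R m)%E (@tcons R m)
  end.

Section leb_is_sigma_finite_measure.
Variable R : realType.

Lemma measurable_tcons (n : nat) : measurable_fun [set: _] (@tcons R n).
Proof. exact: (measurable_cons measurable_fst measurable_snd). Qed.

Variables (n : nat) (m : {sigma_finite_measure set (tup R n) -> \bar R}).
Let leb_succ := pushforward (lebesgue_measure \x m)%E (@tcons R n).

Let leb_succ0 : leb_succ set0 = 0%E.
Proof. by rewrite /leb_succ /pushforward preimage_set0 measure0. Qed.

Let leb_succ_ge0 A : (0 <= leb_succ A)%E.
Proof. by rewrite /leb_succ /pushforward measure_ge0. Qed.

Let leb_succ_sigma_additive : semi_sigma_additive leb_succ.
Proof.
move=> F mF tF mUF; rewrite /leb_succ /pushforward preimage_bigcup.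
have mpre A : measurable A -> measurable (@tcons R n @^-1` A).
  by move=> mA; rewrite -[X in measurable X]setTI; exact: measurable_tcons.
apply: measure_semi_sigma_additive.
- by move=> k; exact: mpre.
- apply/trivIsetP => /= i j _ _ ij; rewrite -preimage_setI.
  by move/trivIsetP : tF => /(_ _ _ _ _ ij) ->//; rewrite preimage_set0.
- by rewrite -preimage_bigcup; exact: mpre.
Qed.

HB.instance Definition _ := isMeasure.Build _ _ _
  leb_succ leb_succ0 leb_succ_ge0 leb_succ_sigma_additive.

Let leb_succ_sigma_finite : sigma_finite setT leb_succ.
Proof.
have /sigma_finiteP[F [FT ndF mF]] := sigma_finiteT (@lebesgue_measure R).
have /sigma_finiteP[G [GT ndG mG]] := sigma_finiteT m.
pose unc (t : tup R n.+1) : measurableTypeR R * tup R n := (thead t, [tuple of behead t]).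
have tconsK : cancel (@tcons R n) unc.
  by move=> [x s]; rewrite /unc /tcons theadE; congr pair; exact: val_inj.
have munc : measurable_fun setT unc.
  apply/measurable_fun_pairP; split; last exact: measurable_behead.
  exact: (@measurable_tnth _ _ _ ord0).
exists (fun k => unc @^-1` (F k `*` G k)).
  rewrite -preimage_bigcup; apply/seteqP; split => // t _.
  have [i _ Fi] : (\bigcup_i F i) (unc t).1 by rewrite -FT.
  have [j _ Gj] : (\bigcup_i G i) (unc t).2 by rewrite -GT.
  exists (maxn i j) => //; split.
  - by move: (unc t).1 Fi; exact/subsetPset/ndF/leq_maxl.
  - by move: (unc t).2 Gj; exact/subsetPset/ndG/leq_maxr.
move=> k; have [mFk Fkoo] := mF k; have [mGk Gkoo] := mG k; split.
  by rewrite -[X in measurable X]setTI; apply: munc => //; exact: measurableX.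
rewrite /leb_succ /pushforward -comp_preimage (_ : unc \o _ = id); last first.
  exact/funext.
by rewrite preimage_id product_measure1E// lte_mul_pinfty// ge0_fin_numE.
Qed.

HB.instance Definition _ :=
  Measure_isSigmaFinite.Build _ _ _ leb_succ leb_succ_sigma_finite.

Definition leb_step : {sigma_finite_measure set (tup R n.+1) -> \bar R} :=
  leb_succ.

End leb_is_sigma_finite_measure.

Section leb_measure.
Variable R : realType.

Let d0 : {sigma_finite_measure set (tup R 0) -> \bar R} := \d_ ([tuple] : tup R 0).

Let leb_ex (n : nat) :
  exists m : {sigma_finite_measure set (tup R n) -> \bar R}, @leb R n = m.
Proof.
elim: n => [|n [m mE]]; first by exists d0.
by exists (leb_step m); rewrite /= mE.
Qed.

Variable n : nat.

Let leb0 : @leb R n set0 = 0%E.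
Proof. by have [m ->] := leb_ex n; exact: measure0. Qed.

Let leb_ge0 A : (0 <= @leb R n A)%E.
Proof. by have [m ->] := leb_ex n; exact: measure_ge0. Qed.

Let leb_sigma_additive : semi_sigma_additive (@leb R n).
Proof. by have [m ->] := leb_ex n; exact: measure_semi_sigma_additive. Qed.

HB.instance Definition _ := isMeasure.Build _ _ _
  (@leb R n) leb0 leb_ge0 leb_sigma_additive.

Let leb_sigma_finite : sigma_finite setT (@leb R n).
Proof. by have [m ->] := leb_ex n; exact: sigma_finiteT. Qed.

HB.instance Definition _ :=
  Measure_isSigmaFinite.Build _ _ _ (@leb R n) leb_sigma_finite.

End leb_measure.

(* The space dimension is d = n.+1 throughout; points of R^d and vectors are
   rows.  The norm that the library puts on 'rV is the max norm, so Euclidean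
   lengths are taken from dotp; the topologies agree. *)
Notation pt R n := ('rV[R]_n.+1).

Section tensors.
Variables (R : realType) (n : nat).
Implicit Types (a b x y : pt R n) (C D : 'M[R]_n.+1) (f : pt R n -> pt R n).

Definition dotp a b : R := \sum_i a 0 i * b 0 i.
Definition enorm a : R := Num.sqrt (dotp a a).
Definition otimes a b : 'M[R]_n.+1 := \matrix_(i, j) (a 0 i * b 0 j).
Definition ddot C D : R := \sum_i \sum_j C i j * D i j.

(* (grad f)_{ij} = d f_j / d x_i *)
Definition grad f x : 'M[R]_n.+1 :=
  \matrix_(i, j) 'D_(delta_mx 0 i : pt R n) (fun y => f y 0 j) x.
Definition sgrad f x := 2^-1 *: (grad f x + (grad f x)^T).
Definition agrad f x := 2^-1 *: (grad f x - (grad f x)^T).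
Definition divg f x : R := \sum_i grad f x i i.

End tensors.

Section geometry.
Variables (R : realType) (n : nat).

Definition pt_of_tuple (s : tup R n.+1) : pt R n := \row_i tnth s i.

Definition bdry (A : set (pt R n)) : set (pt R n) := closure A `\` interior A.

Definition hull (m : nat) (a : 'I_m -> pt R n) : set (pt R n) :=
  [set x | exists c : 'I_m -> R,
    [/\ forall i, 0 <= c i, \sum_i c i = 1 & x = \sum_i c i *: a i]].

(* relative interior of [hull a] when [a] is affinely independent *)
Definition ohull (m : nat) (a : 'I_m -> pt R n) : set (pt R n) :=
  [set x | exists c : 'I_m -> R,
    [/\ forall i, 0 < c i, \sum_i c i = 1 & x = \sum_i c i *: a i]].

Definition refsimplex (m : nat) : set (tup R m) :=
  [set s | (forall j, 0 <= (tnth s j : R)) /\ \sum_j (tnth s j : R) <= 1].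

(* Polynomial functions of total degree at most k on R^d, and restrictions of
   such functions to a subset of R^d. *)
Definition Pk (k : nat) (f : pt R n -> R) : Prop :=
  exists c : {ffun 'I_n.+1 -> 'I_k.+1} -> R, forall x,
    f x = \sum_(a : {ffun 'I_n.+1 -> 'I_k.+1} | (\sum_i a i <= k)%N)
            c a * \prod_i x 0 i ^+ a i.

Definition Pk_on (D : set (pt R n)) (k : nat) (f : pt R n -> R) : Prop :=
  exists2 g, Pk k g & forall x, D x -> f x = g x.

End geometry.

(* Data of the initial boundary value problem.  Time comes first; functions
   given only on part of R^d or of the time axis are represented by total
   functions whose other values are irrelevant (g_v and g_m are also used at
   t = 0, where the trace spaces are already constrained). *)
Record mhd_problem (R : realType) (n : nat) := MHDProblem {
  Omega : set (pt R n);
  GammaD : set (pt R n);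
  GammaN : set (pt R n);
  rho : R;
  mu0 : R;
  nu : R -> pt R n -> R;
  eta : R -> pt R n -> R;
  f_v : R -> pt R n -> pt R n;
  f_m : R -> pt R n -> pt R n;
  g_v : R -> pt R n -> pt R n;
  g_m : R -> pt R n -> pt R n;
  h_v : R -> pt R n -> pt R n;
  h_m : R -> pt R n -> pt R n;
  u_0 : pt R n -> pt R n;
  B_0 : pt R n -> pt R n;
  Omega_neq0 : Omega !=set0;
  Omega_open : open Omega;
  Omega_connected : connected Omega;
  Omega_bounded : bounded_set Omega;
  bdry_Omega : bdry Omega = closure (GammaD `|` GammaN);
  GammaDN_disjoint : GammaD `&` GammaN = set0;
  rho_gt0 : 0 < rho;
  mu0_gt0 : 0 < mu0;
  nu_gt0 : forall t x, 0 < t -> Omega x -> 0 < nu t x;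
  eta_gt0 : forall t x, 0 < t -> Omega x -> 0 < eta t x
}.

(* Facet [i] of element [e] is the one opposite to vertex [i]. *)
Definition facet_vtx (R : realType) (n m : nat) (T : finType)
    (vtx : T -> 'I_m.+1 -> pt R n) (e : T) (i : 'I_m.+1) : 'I_m -> pt R n :=
  fun j => vtx e (lift i j).

(* number of elements of which F is a facet *)
Definition n_sharing (R : realType) (n : nat) (T : finType)
    (vtx : T -> 'I_n.+2 -> pt R n) (F : set (pt R n)) : nat :=
  #|[set e : T | `[< exists i, hull (facet_vtx vtx e i) = F >]]|.

Record mesh (R : realType) (n : nat) (O : set (pt R n)) := Mesh {
  elt : finType;
  vtx : elt -> 'I_n.+2 -> pt R n;
  nrm : elt -> 'I_n.+2 -> pt R n;
  vtx_nondegenerate : forall e,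
    \det (\matrix_(j < n.+1) (vtx e (lift ord0 j) - vtx e ord0)) != 0;
  elt_sub : forall e, ohull (vtx e) `<=` O;
  elt_disjoint : forall e e', e != e' ->
    ohull (vtx e) `&` ohull (vtx e') = set0;
  elt_cover : closure O = \bigcup_e hull (vtx e);
  (* the intersection of two closed elements is a common face *)
  elt_conforming : forall e e' x,
    hull (vtx e) x -> hull (vtx e') x ->
    exists c : 'I_n.+2 -> R,
      [/\ forall i, 0 <= c i, \sum_i c i = 1,
          x = \sum_i c i *: vtx e i
        & forall i, 0 < c i -> exists j, vtx e' j = vtx e i];
  (* every facet is a boundary facet, which belongs to one element, or an
     interior facet, which is shared by two *)
  facet_dichotomy : forall e i,
    let F := hull (facet_vtx vtx e i) in
    (F `<=` bdry O /\ n_sharing vtx F = 1%N) \/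
    (ohull (facet_vtx vtx e i) `<=` O /\ n_sharing vtx F = 2%N);
  nrm_unit : forall e i, dotp (nrm e i) (nrm e i) = 1;
  nrm_orthogonal : forall e i j j',
    dotp (nrm e i) (facet_vtx vtx e i j - facet_vtx vtx e i j') = 0;
  nrm_outward : forall e i j,
    dotp (nrm e i) (vtx e i - facet_vtx vtx e i j) < 0
}.

Section mesh_integrals.
Variables (R : realType) (n : nat) (O : set (pt R n)) (M : mesh O).
Implicit Types (e : elt M) (i : 'I_n.+2) (A : set (pt R n)).

Definition element e : set (pt R n) := ohull (vtx e).
Definition facet e i : set (pt R n) := hull (facet_vtx (@vtx _ _ _ M) e i).

Definition diam e : R :=
  sup [set enorm (x - y) | x in element e & y in element e].

Definition elt_dom e : set (tup R n.+1) := @pt_of_tuple R n @^-1` element e.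

Definition int_elt e (f : pt R n -> R) : R :=
  \int[@leb R n.+1]_(s in elt_dom e) f (pt_of_tuple s).
Definition vint_elt e (f : pt R n -> pt R n) : pt R n :=
  \row_j int_elt e (fun x => f x 0 j).

(* Integration over facet [i] of [e] intersected with [A]: the facet is the
   image of the reference simplex of R^(d-1) under [facet_par e i], whose
   surface element is the square root of the Gram determinant. *)
Definition facet_edges e i : 'M[R]_(n, n.+1) :=
  \matrix_(j < n)
    (facet_vtx (@vtx _ _ _ M) e i (lift ord0 j)
     - facet_vtx (@vtx _ _ _ M) e i ord0).
Definition facet_par e i (s : tup R n) : pt R n :=
  facet_vtx (@vtx _ _ _ M) e i ord0
  + \sum_j (tnth s j : R) *: row j (facet_edges e i).
Definition facet_jac e i : R :=
  Num.sqrt (\det (facet_edges e i *m (facet_edges e i)^T)).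

Definition facet_dom e i A : set (tup R n) :=
  @refsimplex R n `&` facet_par e i @^-1` A.

Definition int_facet e i A (f : pt R n -> R) : R :=
  facet_jac e i * \int[@leb R n]_(s in facet_dom e i A) f (facet_par e i s).
Definition vint_facet e i A (f : pt R n -> pt R n) : pt R n :=
  \row_j int_facet e i A (fun x => f x 0 j).

Definition integrable_elt e (f : pt R n -> R) : Prop :=
  (@leb R n.+1).-integrable (elt_dom e) (fun s => (f (pt_of_tuple s))%:E).
Definition integrable_facet e i A (f : pt R n -> R) : Prop :=
  (@leb R n).-integrable (facet_dom e i A) (fun s => (f (facet_par e i s))%:E).

(* P holds almost everywhere, for surface measure, on facet [i] of [e]
   intersected with [A] *)
Definition ae_facet e i A (P : pt R n -> Prop) : Prop :=
  {ae @leb R n, forall s, facet_dom e i A s -> P (facet_par e i s)}.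

(* A function on Omega that is polynomial on each element is represented by
   the family of these polynomials, each extended to R^d; the value of the
   family at a point of the boundary of [e] is the trace from inside [e].
   A function on the mesh skeleton that is polynomial on each facet is
   represented by a family indexed by the facets, as sets of points, so that
   it is single-valued on a facet shared by two elements. *)
Definition elt_field (T : Type) := elt M -> pt R n -> T.
Definition skel_field (T : Type) := set (pt R n) -> pt R n -> T.

Variable k : nat.

Definition Vspace (v : elt_field (pt R n)) : Prop :=
  forall e j, Pk k (fun x => v e x 0 j).
Definition Qspace (q : elt_field R) : Prop :=
  forall e, Pk k.-1 (q e).
Definition Vhat (v : skel_field (pt R n)) : Prop :=
  forall e i j, Pk_on (facet e i) k (fun x => v (facet e i) x 0 j).
Definition Qhat (q : skel_field R) : Prop :=
  forall e i, Pk_on (facet e i) k (q (facet e i)).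
Definition Vhat_eq (GD : set (pt R n)) (g : pt R n -> pt R n)
    (v : skel_field (pt R n)) : Prop :=
  Vhat v /\ forall e i, ae_facet e i GD (fun x => v (facet e i) x = g x).

End mesh_integrals.

Section hdg_method.
Variables (R : realType) (n : nat) (P : mhd_problem R n) (M : mesh (Omega P)).
Implicit Types (e : elt M) (i : 'I_n.+2) (t : R).

Local Notation velt := (elt_field M (pt R n)).
Local Notation selt := (elt_field M R).
Local Notation vskel := (set (pt R n) -> pt R n -> pt R n).
Local Notation sskel := (set (pt R n) -> pt R n -> R).

(* The data are integrable wherever they are integrated. *)
Record regular_data : Prop := RegularData {
  reg_GammaD : forall e i, measurable (facet_dom e i (GammaD P));
  reg_GammaN : forall e i, measurable (facet_dom e i (GammaN P));
  reg_nu : forall t e, 0 < t -> integrable_elt e (nu P t);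
  reg_eta : forall t e, 0 < t -> integrable_elt e (eta P t);
  reg_nu_facet : forall t e i, 0 < t -> integrable_facet e i setT (nu P t);
  reg_eta_facet : forall t e i, 0 < t -> integrable_facet e i setT (eta P t);
  reg_f_v : forall t e j, 0 < t -> integrable_elt e (fun x => f_v P t x 0 j);
  reg_f_m : forall t e j, 0 < t -> integrable_elt e (fun x => f_m P t x 0 j);
  reg_h_v : forall t e i j, 0 < t ->
    integrable_facet e i (GammaN P) (fun x => h_v P t x 0 j);
  reg_h_m : forall t e i j, 0 < t ->
    integrable_facet e i (GammaN P) (fun x => h_m P t x 0 j);
  reg_u_0 : forall e j, integrable_elt e (fun x => u_0 P x 0 j);
  reg_B_0 : forall e j, integrable_elt e (fun x => B_0 P x 0 j)
}.

Record hdg_fields := HDGFields {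
  uh : R -> velt;
  uhat : R -> vskel;
  ph : R -> selt;
  phat : R -> sskel;
  Bh : R -> velt;
  Bhat : R -> vskel;
  rh : R -> selt;
  rhat : R -> sskel
}.

Definition time_differentiable (v : R -> velt) : Prop :=
  (forall t e x, 0 < t -> derivable (fun s => v s e x) t 1) /\
  (forall e x, cvg (h^-1 *: (v h e x - v 0 e x) @[h --> 0^'+])).

Definition dt (v : R -> velt) (t : R) : velt :=
  fun e x => derive1 (fun s => v s e x) t.

Variables (k : nat) (Cpen : R) (S : hdg_fields).

Definition lam t e i (x : pt R n) : R :=
  if dotp (uh S t e x) (nrm e i) < 0 then 1 else 0.

Definition maxwell (b : pt R n) : 'M[R]_n.+1 :=
  (rho P * mu0 P)^-1 *: (otimes b b - (2^-1 * dotp b b) *: 1%:M).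

Definition flux_v t e i (x : pt R n) : 'M[R]_n.+1 :=
  let F := facet e i in
  (1 - lam t e i x) *: otimes (uh S t e x) (uh S t e x)
  + lam t e i x *: otimes (uh S t e x) (uhat S t F x)
  + ((rho P)^-1 * phat S t F x) *: 1%:M
  - (2 * nu P t x) *: sgrad (uh S t e) x
  + (2 * (Cpen / diam e) * nu P t x)
      *: otimes (nrm e i) (uh S t e x - uhat S t F x)
  - maxwell (Bhat S t F x).

Definition flux_m t e i (x : pt R n) : 'M[R]_n.+1 :=
  let F := facet e i in
  (1 - lam t e i x) *: otimes (uh S t e x) (Bh S t e x)
  + lam t e i x *: otimes (uh S t e x) (Bhat S t F x)
  + rhat S t F x *: 1%:M
  - (2 * (eta P t x / mu0 P)) *: agrad (Bh S t e) x
  + (2 * (eta P t x / mu0 P) * (Cpen / diam e))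
      *: otimes (nrm e i) (Bh S t e x - Bhat S t F x).

Definition eqS1 t (v : velt) : Prop :=
  \sum_(e : elt M) int_elt e (fun x =>
      dotp (dt (uh S) t e x) (v e x)
      - ddot (otimes (uh S t e x) (uh S t e x)) (grad (v e) x)
      - (rho P)^-1 * ddot (ph S t e x *: 1%:M) (grad (v e) x)
      + 2 * nu P t x * ddot (sgrad (uh S t e) x) (sgrad (v e) x)
      + ddot (maxwell (Bh S t e x)) (grad (v e) x)
      - dotp (f_v P t x) (v e x))
  + \sum_(e : elt M) \sum_(i < n.+2) int_facet e i setT (fun x =>
      ddot (flux_v t e i x) (otimes (nrm e i) (v e x)))
  - \sum_(e : elt M) \sum_(i < n.+2) int_facet e i setT (fun x =>
      2 * nu P t x *
      ddot (otimes (nrm e i) (uh S t e x - uhat S t (facet e i) x))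
           (sgrad (v e) x))
  = 0.

Definition eqS2 t (v : vskel) : Prop :=
  \sum_(e : elt M) \sum_(i < n.+2) int_facet e i setT (fun x =>
      ddot (flux_v t e i x) (otimes (nrm e i) (v (facet e i) x)))
  - \sum_(e : elt M) \sum_(i < n.+2) int_facet e i (GammaN P) (fun x =>
      (1 - lam t e i x) *
      ddot (otimes (uh S t e x) (uhat S t (facet e i) x))
           (otimes (nrm e i) (v (facet e i) x)))
  + \sum_(e : elt M) \sum_(i < n.+2) int_facet e i (GammaN P) (fun x =>
      dotp (h_v P t x) (v (facet e i) x))
  = 0.

Definition eqS3 t (q : selt) : Prop :=
  \sum_(e : elt M) int_elt e (fun x => (rho P)^-1 * divg (uh S t e) x * q e x) = 0.

Definition eqS4 t (q : sskel) : Prop :=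
  \sum_(e : elt M) \sum_(i < n.+2) int_facet e i setT (fun x =>
      (rho P)^-1 * dotp (uh S t e x - uhat S t (facet e i) x) (nrm e i)
      * q (facet e i) x) = 0.

Definition eqS5 t (w : velt) : Prop :=
  \sum_(e : elt M) int_elt e (fun x =>
      dotp (dt (Bh S) t e x) (w e x)
      - ddot (otimes (uh S t e x) (Bh S t e x)) (grad (w e) x)
      - ddot (rh S t e x *: 1%:M) (grad (w e) x)
      + 2 * (eta P t x / mu0 P) * ddot (agrad (Bh S t e) x) (agrad (w e) x)
      - ddot (otimes (Bh S t e x) (w e x)) (grad (uh S t e) x)
      - dotp (f_m P t x) (w e x))
  + \sum_(e : elt M) \sum_(i < n.+2) int_facet e i setT (fun x =>
      ddot (flux_m t e i x) (otimes (nrm e i) (w e x)))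
  - \sum_(e : elt M) \sum_(i < n.+2) int_facet e i setT (fun x =>
      2 * (eta P t x / mu0 P) *
      ddot (otimes (nrm e i) (Bh S t e x - Bhat S t (facet e i) x))
           (agrad (w e) x))
  = 0.

Definition eqS6 t (w : vskel) : Prop :=
  \sum_(e : elt M) \sum_(i < n.+2) int_facet e i setT (fun x =>
      ddot (flux_m t e i x) (otimes (nrm e i) (w (facet e i) x)))
  - \sum_(e : elt M) \sum_(i < n.+2) int_facet e i setT (fun x =>
      let b := Bhat S t (facet e i) x in
      let c := w (facet e i) x in
      ddot (otimes b c - (2^-1 * dotp b c) *: 1%:M)
           (otimes (nrm e i) (uh S t e x - uhat S t (facet e i) x)))
  - \sum_(e : elt M) \sum_(i < n.+2) int_facet e i (GammaN P) (fun x =>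
      (1 - lam t e i x) *
      ddot (otimes (uh S t e x) (Bhat S t (facet e i) x))
           (otimes (nrm e i) (w (facet e i) x)))
  + \sum_(e : elt M) \sum_(i < n.+2) int_facet e i (GammaN P) (fun x =>
      dotp (h_m P t x) (w (facet e i) x))
  = 0.

Definition eqS7 t (q : selt) : Prop :=
  \sum_(e : elt M) int_elt e (fun x => q e x * divg (Bh S t e) x) = 0.

Definition eqS8 t (q : sskel) : Prop :=
  \sum_(e : elt M) \sum_(i < n.+2) int_facet e i setT (fun x =>
      dotp (Bh S t e x - Bhat S t (facet e i) x) (nrm e i)
      * q (facet e i) x) = 0.

Definition eqS9 (v : velt) : Prop :=
  \sum_(e : elt M) int_elt e (fun x => dotp (uh S 0 e x - u_0 P x) (v e x)) = 0.

Definition eqS10 (w : velt) : Prop :=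
  \sum_(e : elt M) int_elt e (fun x => dotp (Bh S 0 e x - B_0 P x) (w e x)) = 0.

Record hdg_solution : Prop := HDGSolution {
  sol_uh : forall t, 0 <= t -> Vspace k (uh S t);
  sol_uhat : forall t, 0 <= t -> Vhat_eq M k (GammaD P) (g_v P t) (uhat S t);
  sol_ph : forall t, 0 <= t -> Qspace k (ph S t);
  sol_phat : forall t, 0 <= t -> Qhat M k (phat S t);
  sol_Bh : forall t, 0 <= t -> Vspace k (Bh S t);
  sol_Bhat : forall t, 0 <= t -> Vhat_eq M k (GammaD P) (g_m P t) (Bhat S t);
  sol_rh : forall t, 0 <= t -> Qspace k (rh S t);
  sol_rhat : forall t, 0 <= t -> Qhat M k (rhat S t);
  sol_uh_diff : time_differentiable (uh S);
  sol_Bh_diff : time_differentiable (Bh S);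
  sol_S1 : forall t v, 0 < t -> Vspace k v -> eqS1 t v;
  sol_S2 : forall t v, 0 < t -> Vhat_eq M k (GammaD P) (fun=> 0) v -> eqS2 t v;
  sol_S3 : forall t q, 0 < t -> Qspace k q -> eqS3 t q;
  sol_S4 : forall t q, 0 < t -> Qhat M k q -> eqS4 t q;
  sol_S5 : forall t w, 0 < t -> Vspace k w -> eqS5 t w;
  sol_S6 : forall t w, 0 < t -> Vhat_eq M k (GammaD P) (fun=> 0) w -> eqS6 t w;
  sol_S7 : forall t q, 0 < t -> Qspace k q -> eqS7 t q;
  sol_S8 : forall t q, 0 < t -> Qhat M k q -> eqS8 t q;
  sol_S9 : forall v, Vspace k v -> eqS9 v;
  sol_S10 : forall w, Vspace k w -> eqS10 w
}.

End hdg_method.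

(* Main.v *)
(** Testing (S1) and (S2) with the constant field e_j cancels the numerical fluxes
    and leaves the j-th component of the identity, except that the momentum flux
    through Gamma_N carries u . n in place of uhat . n.  These two agree almost
    everywhere on a boundary facet, by testing (S4) there with the polynomial
    (u - uhat) . n itself; an interior facet meets Gamma_N at most in its
    relative boundary, which is negligible.  The time derivative passes through
    the integral because u(t, .) is the interpolation of its values at a fixed
    finite grid, with fixed coefficient functions. *)

Require Import Defs.
From HB Require Import structures.
From mathcomp Require Import all_boot all_order all_algebra.
From mathcomp Require Import all_classical all_reals all_analysis measurable_realfun.
Import Order.TTheory GRing.Theory Num.Theory.
Import numFieldNormedType.Exports.
Local Open Scope classical_set_scope.
Local Open Scope ring_scope.
Set Implicit Arguments.
Unset Strict Implicit.
Unset Printing Implicit Defensive.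

(** * Bounded measurable functions and their integrals *)

Section measurable_bounded.
Context d (T : measurableType d) (R : realType).
Implicit Types (D : set T) (f g : T -> R).

(** A class closed under the algebra of polynomials, integrable on measurable sets of finite
    measure. It supplies at once the measurability needed to change integrands almost everywhere and
    the integrability needed for linearity. *)
Definition measurable_bounded D f :=
  measurable_fun D f /\ exists C, forall x, D x -> `|f x| <= C.

Lemma measurable_bounded_cst D (c : R) : measurable_bounded D (fun=> c).
Proof. by split; [exact: measurable_cst|exists `|c|]. Qed.

Lemma measurable_boundedD D f g : measurable_bounded D f ->
  measurable_bounded D g -> measurable_bounded D (fun x => f x + g x).
Proof.
move=> [mf [A fA]] [mg [B gB]]; split; first exact: measurable_funD.
exists (A + B) => x Dx; rewrite (le_trans (ler_normD _ _))//.
by rewrite lerD ?fA ?gB.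
Qed.

Lemma measurable_boundedM D f g : measurable_bounded D f ->
  measurable_bounded D g -> measurable_bounded D (fun x => f x * g x).
Proof.
move=> [mf [A fA]] [mg [B gB]]; split; first exact: measurable_funM.
by exists (A * B) => x Dx; rewrite normrM ler_pM ?fA ?gB.
Qed.

Lemma measurable_boundedB D f g : measurable_bounded D f ->
  measurable_bounded D g -> measurable_bounded D (fun x => f x - g x).
Proof.
move=> fb gb; under eq_fun do rewrite -mulN1r.
by apply/measurable_boundedD/measurable_boundedM/gb; last exact: measurable_bounded_cst.
Qed.

Lemma measurable_bounded_sum D (I : Type) (r : seq I) (P : pred I)
    (F : I -> T -> R) : (forall i, P i -> measurable_bounded D (F i)) ->
  measurable_bounded D (fun x => \sum_(i <- r | P i) F i x).
Proof.
move=> Fb; elim: r => [|i r IH].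
  by under eq_fun do rewrite big_nil; exact: measurable_bounded_cst.
under eq_fun do rewrite big_cons; case: (boolP (P i)) => [Pi|_] //.
exact: measurable_boundedD (Fb _ Pi) IH.
Qed.

Lemma measurable_bounded_prod D (I : Type) (r : seq I) (F : I -> T -> R) :
  (forall i, measurable_bounded D (F i)) ->
  measurable_bounded D (fun x => \prod_(i <- r) F i x).
Proof.
move=> Fb; elim: r => [|i r IH].
  by under eq_fun do rewrite big_nil; exact: measurable_bounded_cst.
by under eq_fun do rewrite big_cons; exact: measurable_boundedM.
Qed.

Lemma measurable_boundedX D f k : measurable_bounded D f ->
  measurable_bounded D (fun x => f x ^+ k).
Proof.
move=> fb; elim: k => [|k IH]; first exact: measurable_bounded_cst.
by under eq_fun do rewrite exprS; exact: measurable_boundedM.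
Qed.

Lemma measurable_boundedS D D' f : measurable D -> measurable D' -> D' `<=` D ->
  measurable_bounded D f -> measurable_bounded D' f.
Proof.
move=> mD mD' DD' [mf [C fC]]; split; first exact: measurable_funS mf.
by exists C => x /DD' /fC.
Qed.

Lemma eq_measurable_bounded D f g : (forall x, D x -> f x = g x) ->
  measurable_bounded D f -> measurable_bounded D g.
Proof.
move=> fg [mf [C fC]]; split.
  by apply: eq_measurable_fun mf => x /set_mem/fg.
by exists C => x Dx; rewrite -fg// fC.
Qed.

Lemma measurable_bounded_if D f g (b : T -> bool) : measurable D ->
  measurable_fun D b -> measurable_bounded D f -> measurable_bounded D g ->
  measurable_bounded D (fun x => if b x then f x else g x).
Proof.
move=> mD mb [mf [A fA]] [mg [B gB]]; split.
  by apply: measurable_fun_if => //; apply: measurable_funS mD _ _ => //; exact: subIsetl.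
exists (Num.max A B) => x Dx; case: ifP => _.
  by rewrite le_max fA.
by rewrite le_max gB// orbT.
Qed.

Lemma integrable_measurable_bounded (mu : {measure set T -> \bar R}) D f :
  measurable D -> (mu D < +oo)%E -> measurable_bounded D f ->
  mu.-integrable D (EFin \o f).
Proof.
move=> mD muD [mf [C fC]]; apply: measurable_bounded_integrable => //.
exists C; split; first exact: num_real.
by move=> M CM x Dx; apply: le_trans (fC _ Dx) _; exact: ltW.
Qed.

Lemma Rintegral_sum (mu : {measure set T -> \bar R}) D (I : Type) (r : seq I)
    (F : I -> T -> R) : measurable D ->
  (forall i, mu.-integrable D (EFin \o F i)) ->
  \int[mu]_(x in D) (\sum_(i <- r) F i x) =
  \sum_(i <- r) \int[mu]_(x in D) F i x.
Proof.
move=> mD iF; elim: r => [|i r IH].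
  under eq_Rintegral do rewrite big_nil.
  by rewrite Rintegral_cst// mul0r big_nil.
under eq_Rintegral do rewrite big_cons.
rewrite RintegralD//; first by rewrite IH big_cons.
have := @integrable_sum _ _ _ mu _ mD _ r predT (fun i => EFin \o F i) (fun i _ => iF i).
by apply: eq_integrable => // x _; rewrite /= sumEFin.
Qed.

Lemma ae_eq_Rintegral (mu : {measure set T -> \bar R}) D f g : measurable D ->
  measurable_fun D f -> measurable_fun D g ->
  {ae mu, forall x, D x -> f x = g x} ->
  \int[mu]_(x in D) f x = \int[mu]_(x in D) g x.
Proof.
move=> mD mf mg fg; rewrite /Rintegral; congr fine; apply: ae_eq_integral => //.
- exact/measurable_EFinP.
- exact/measurable_EFinP.
- by apply: filterS fg => x fg Dx; rewrite fg.
Qed.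

Lemma Rintegral_eq0_ae (mu : {measure set T -> \bar R}) D f : measurable D ->
  mu.-integrable D (EFin \o f) -> (forall x, D x -> 0 <= f x) ->
  \int[mu]_(x in D) f x = 0 -> {ae mu, forall x, D x -> f x = 0}.
Proof.
move=> mD fi f0 fint0.
have mf : measurable_fun D (EFin \o f) by case/integrableP : fi.
have : (\int[mu]_(x in D) `|(EFin \o f) x| = 0)%E.
  (* Since [fine] also sends infinite values to 0, it is the finiteness given by integrability that
     makes the extended integral vanish. *)
  rewrite -[RHS]/(0%:E) -fint0 /Rintegral fineK; last exact: integrable_fin_num.
  by apply: eq_integral => x /set_mem Dx; rewrite /= ger0_norm// f0.
move/(ae_eq_integral_abs mu mD mf); apply: filterS => x /= + Dx => /(_ Dx).
by case.
Qed.

End measurable_bounded.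

(** * Finite and null sets for Lebesgue measure on tuples *)

Section lebesgue_measure_on_tuples.
Variable R : realType.

Lemma measurable_tcons_preimage n (A : set (tup R n.+1)) :
  measurable A -> measurable (@tcons R n @^-1` A).
Proof. by move=> mA; rewrite -[X in measurable X]setTI; exact: measurable_tcons. Qed.

Lemma measurable_forall_tnth n (A : set (measurableTypeR R)) : measurable A ->
  measurable [set s : tup R n | forall j, A (tnth s j)].
Proof.
move=> mA; rewrite (_ : [set _ | _] =
  \big[setI/setT]_(j < n) ((fun s : tup R n => tnth s j) @^-1` A)).
  apply: bigsetI_measurable => j _; rewrite -[X in measurable X]setTI.
  exact: measurable_tnth.
apply/seteqP; split=> s /=.
  by move=> sA; elim/big_ind: _ => //= j _; exact: sA.
by move=> + j; rewrite (bigD1 j)//= => -[].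
Qed.

(** A cube is an interval times a cube of one dimension less; in dimension 0 the measure is a Dirac
    mass. *)
Lemma leb_cube_fin (C : R) n :
  (@leb R n [set s | forall j, (`[- C, C]%classic : set R) (tnth s j)]%R < +oo)%E.
Proof.
elim: n => [|n IH].
  by rewrite /= diracE; case: (_ \in _); rewrite ltry.
rewrite [leb _]/= /pushforward (_ : _ @^-1` _ = `[- C, C]%classic `*`
  [set s : tup R n | forall j, (`[- C, C]%classic : set R) (tnth s j)]); last first.
  apply/seteqP; split=> -[x s] /=.
    by move=> H; split=> [|j]; [have := H ord0|have := H (lift ord0 j)];
      rewrite /tcons ?tnth0 ?tnthS.
  by move=> [H1 H2] j; case: (unliftP ord0 j) => [i|] ->; rewrite /tcons ?tnth0 ?tnthS.
rewrite product_measure1E//; last exact: measurable_forall_tnth.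
rewrite lte_mul_pinfty//=.
by rewrite lebesgue_measure_itv/=; case: ifP.
Qed.

Lemma leb_bounded_fin n (D : set (tup R n)) (C : R) : measurable D ->
  (forall s, D s -> forall j, `|tnth s j : R| <= C) -> (@leb R n D < +oo)%E.
Proof.
move=> mD DC; apply: le_lt_trans (leb_cube_fin C n).
apply: le_measure; rewrite ?inE//; first exact: measurable_forall_tnth.
by move=> s Ds j; rewrite /= in_itv/= -ler_norml DC.
Qed.

(** Fubini: [leb] is built by fixing the head and measuring tails. Uniqueness of the product measure
    allows the other order, which fixes the tail and measures heads. *)
Lemma leb_null_slices n (A : set (tup R n.+1)) : measurable A ->
  (forall s, lebesgue_measure [set x : measurableTypeR R | A (tcons (x, s))] = 0%E) ->
  @leb R n.+1 A = 0%E.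
Proof.
move=> mA A0; rewrite [leb _]/= /pushforward.
rewrite (@product_measure_unique _ _ _ _ R lebesgue_measure (@leb R n)
  (lebesgue_measure \x^ @leb R n)%E); first last.
- exact: measurable_tcons_preimage.
- by move=> *; exact: product_measure2E.
apply: integral0_eq => s _ /=.
rewrite -(A0 s); congr (lebesgue_measure _).
by apply/seteqP; split=> x /=; rewrite /ysection /= inE.
Qed.

Lemma leb_null_slices_tail n (A : set (tup R n.+1)) :
  (forall x, @leb R n [set s | A (tcons (x, s))] = 0%E) ->
  @leb R n.+1 A = 0%E.
Proof.
move=> A0; rewrite [leb _]/= /pushforward /product_measure1 integral0_eq//= => x _.
rewrite -(A0 x); congr (leb _).
by apply/seteqP; split=> s /=; rewrite /xsection /= inE.
Qed.

(** For the first coordinate, each slice with fixed tail is a point; for any other coordinate,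
    slices with fixed head are null by induction. *)
Lemma leb_coord0 n (j : 'I_n) : @leb R n [set s | (tnth s j : R) = 0] = 0%E.
Proof.
elim: n j => [[]//|n IH] j; case: (unliftP ord0 j) => [i|] ->.
  apply: leb_null_slices_tail => x; rewrite -(IH i); congr (leb _).
  by apply/seteqP; split=> s /=; rewrite /tcons tnthS.
apply: leb_null_slices => [|s].
  rewrite [X in measurable X](_ : _ =
      setT `&` (fun s : tup R n.+1 => tnth s ord0) @^-1` [set (0 : R)]).
    by apply: measurable_tnth.
  by rewrite setTI.
rewrite -(lebesgue_measure_set1 (0 : R)); congr (lebesgue_measure _).
Qed.

(** Once the tail is fixed, the equation determines the head, so each slice is a single point. In
    dimension 0 the sum is 0 and the set is empty. *)
Lemma leb_sum_eq1 n : @leb R n [set s | \sum_j (tnth s j : R) = 1] = 0%E.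
Proof.
case: n => [|n].
  rewrite (_ : [set _ | _] = set0) ?measure0//.
  by apply/seteqP; split=> s//=; rewrite big_ord0 => /eqP; rewrite eq_sym oner_eq0.
apply: leb_null_slices => [|s].
  rewrite [X in measurable X](_ : _ =
      setT `&` (fun s : tup R n.+1 => \sum_j (tnth s j : R)) @^-1` [set (1 : R)]).
    by apply: measurable_sum => // j; exact: measurable_tnth.
  by rewrite setTI.
rewrite -(lebesgue_measure_set1 (1 - \sum_j (tnth s j : R))).
congr (lebesgue_measure _); apply/seteqP; split=> x /=.
  rewrite big_ord_recl /tcons tnth0 => <-.
  by under [X in _ - X]eq_bigr do rewrite -(tnthS x); rewrite addrK.
move=> ->; rewrite big_ord_recl /tcons tnth0.
by under [X in _ + X]eq_bigr do rewrite tnthS; rewrite subrK.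
Qed.

End lebesgue_measure_on_tuples.

(** * Polynomials and interpolation on a tensor grid *)

Section polynomials.
Variables (R : realType) (n k : nat).
Implicit Types (f g : pt R n -> R) (D : set (pt R n)).

Lemma Pk_cst (c : R) : Pk k (fun _ : pt R n => c).
Proof.
exists (fun a => if a == [ffun=> ord0] then c else 0) => x.
rewrite (bigD1 [ffun=> ord0])/=; last by rewrite big1// => i _; rewrite ffunE.
rewrite eqxx big1 ?mulr1 => [|i _]; last by rewrite ffunE expr0.
by rewrite big1 ?addr0// => a /andP[_ /negPf->]; rewrite mul0r.
Qed.

Lemma Pk_linear (a : R) f g :
  Pk k f -> Pk k g -> Pk k (fun x => a * f x + g x).
Proof.
move=> [c fc] [d gd]; exists (fun b => a * c b + d b) => x.
rewrite fc gd mulr_sumr -big_split/=; apply: eq_bigr => b _.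
by rewrite mulrDl mulrA.
Qed.

Lemma Pk_onW D f : Pk k f -> Pk_on D k f.
Proof. by exists f. Qed.

Lemma Pk_on_linear D (a : R) f g :
  Pk_on D k f -> Pk_on D k g -> Pk_on D k (fun x => a * f x + g x).
Proof.
move=> [f' f'P ff'] [g' g'P gg']; exists (fun x => a * f' x + g' x).
  exact: Pk_linear.
by move=> x Dx; rewrite ff'// gg'.
Qed.

Lemma Pk_on_sum D (I : Type) (r : seq I) (a : I -> R) (F : I -> pt R n -> R) :
  (forall i, Pk_on D k (F i)) -> Pk_on D k (fun x => \sum_(i <- r) a i * F i x).
Proof.
move=> FP; elim: r => [|i r IH].
  by under eq_fun do rewrite big_nil; exact/Pk_onW/Pk_cst.
by under eq_fun do rewrite big_cons; exact: Pk_on_linear.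
Qed.

Lemma measurable_bounded_Pk d (T : measurableType d) (A : set T)
    (phi : T -> pt R n) f :
  (forall i, measurable_bounded A (fun s => phi s 0 i)) ->
  Pk k f -> measurable_bounded A (f \o phi).
Proof.
move=> phib [c fc]; rewrite (_ : f \o phi = fun s =>
    \sum_(a : {ffun 'I_n.+1 -> 'I_k.+1} | (\sum_i a i <= k)%N)
      c a * \prod_i phi s 0 i ^+ a i); last by apply/funext => s /=; rewrite fc.
apply: measurable_bounded_sum => a _.
apply: measurable_boundedM; first exact: measurable_bounded_cst.
by apply: measurable_bounded_prod => i; exact: measurable_boundedX.
Qed.

(** The lattice points of {0, ..., k}^d, indexed by the same type as the exponents in [Pk]. *)
Definition grid_node (m : {ffun 'I_n.+1 -> 'I_k.+1}) : pt R n :=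
  \row_i (m i)%:R.

(** Tensor products of the univariate Lagrange basis at the nodes 0, ..., k. They span the
    polynomials of degree at most k in each variable, a space that contains those of total degree at
    most k. *)
Definition grid_lagrange (m : {ffun 'I_n.+1 -> 'I_k.+1}) (x : pt R n) : R :=
  \prod_i (tnth (k.+1.-lagrange (fun j => j%:R)) (m i)).[x 0 i].

Lemma measurable_bounded_grid_lagrange d (T : measurableType d) (A : set T)
    (phi : T -> pt R n) m :
  (forall i, measurable_bounded A (fun s => phi s 0 i)) ->
  measurable_bounded A (grid_lagrange m \o phi).
Proof.
move=> phib; apply: measurable_bounded_prod => i.
under eq_fun do rewrite horner_coef.
apply: measurable_bounded_sum => j _.
apply: measurable_boundedM; first exact: measurable_bounded_cst.
exact: measurable_boundedX.
Qed.

(** By linearity a monomial suffices. It is a product of univariate powers of exponent at most k,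
    each reproduced by interpolation at k+1 nodes. *)
Lemma grid_interpolation f x : Pk k f ->
  f x = \sum_m f (grid_node m) * grid_lagrange m x.
Proof.
move=> [c fc]; rewrite fc; under [RHS]eq_bigr do rewrite fc mulr_suml.
rewrite exchange_big/=; apply: eq_bigr => a _.
under [RHS]eq_bigr do rewrite -mulrA -big_split/=.
rewrite -mulr_sumr; congr (_ * _).
transitivity (\prod_i \sum_(j < k.+1) (j%:R : R) ^+ a i *
    (tnth (k.+1.-lagrange (fun j => j%:R)) j).[x 0 i]).
  apply: eq_bigr => i _.
  have nat_inj : injective (fun j : nat => j%:R : R) by exact/mulrIn/oner_neq0.
  have /(lagrange_gen (ltn0Sn k) nat_inj) Xa : (size ('X^(a i) : {poly R}) <= k.+1)%N.
    by rewrite size_polyXn.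
  rewrite -hornerXn {1}Xa horner_sum; apply: eq_bigr => j _.
  by rewrite hornerM hornerC hornerXn.
(* Expanding the product of sums gives a sum over all choices of one node per coordinate, that is,
   over the grid. *)
rewrite bigA_distr_bigA/=; apply: eq_bigr => m _; apply: eq_bigr => i _.
by rewrite mxE.
Qed.

End polynomials.

(** * Dot products, tensors and gradients of constants *)

Section dot_product.
Variables (R : realType) (n : nat).
Implicit Types a b c : pt R n.

Lemma dotpC a b : dotp a b = dotp b a.
Proof. by apply: eq_bigr => i _; rewrite mulrC. Qed.

Lemma dotpBl a b c : dotp (a - b) c = dotp a c - dotp b c.
Proof. by rewrite -sumrB; apply: eq_bigr => i _; rewrite !mxE mulrBl. Qed.

Lemma dotp_delta a j : dotp a (delta_mx 0 j) = a 0 j.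
Proof.
rewrite /dotp (bigD1 j)//= big1 ?addr0 => [|i ij]; rewrite !mxE eqxx.
  by rewrite eqxx mulr1.
by rewrite (negPf ij) mulr0.
Qed.

Lemma dotp_sumr (I : Type) (r : seq I) a (s : I -> R) (F : I -> pt R n) :
  dotp a (\sum_(i <- r) s i *: F i) = \sum_(i <- r) s i * dotp a (F i).
Proof.
rewrite /dotp; under eq_bigr do rewrite summxE mulr_sumr.
rewrite exchange_big/=; apply: eq_bigr => i _; rewrite mulr_sumr.
by apply: eq_bigr => j _; rewrite mxE mulrCA.
Qed.

Lemma ddot_otimes a b c e :
  ddot (otimes a b) (otimes c e) = dotp a c * dotp b e.
Proof.
rewrite /ddot /dotp mulr_suml; apply: eq_bigr => i _; rewrite mulr_sumr.
by apply: eq_bigr => j _; rewrite !mxE mulrACA.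
Qed.

Lemma ddot0r (C : 'M[R]_n.+1) : ddot C 0 = 0.
Proof. by rewrite /ddot big1// => i _; rewrite big1// => j _; rewrite mxE mulr0. Qed.

Lemma grad_cst (c x : pt R n) : grad (fun=> c) x = 0.
Proof.
apply/matrixP => i j; rewrite !mxE.
exact: derive_cst.
Qed.

Lemma sgrad_cst (c x : pt R n) : sgrad (fun=> c) x = 0.
Proof. by rewrite /sgrad grad_cst trmx0 addr0 scaler0. Qed.

End dot_product.

(** * Barycentric coordinates and the reference simplex *)

Section simplices.
Variables (R : realType) (n m : nat) (a : 'I_m.+1 -> pt R n).

(** Barycentric coordinates of the point with coordinates [b] along the edges issuing from vertex 0;
    vertex 0 receives the missing mass. *)
Definition weights (b : 'I_m -> R) (i : 'I_m.+1) : R :=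
  if unlift ord0 i is Some j then b j else 1 - \sum_j b j.

Lemma weights0 b : weights b ord0 = 1 - \sum_j b j.
Proof. by rewrite /weights unlift_none. Qed.

Lemma weightsS b j : weights b (lift ord0 j) = b j.
Proof. by rewrite /weights liftK. Qed.

Lemma sum_weights b : \sum_i weights b i = 1.
Proof.
rewrite big_ord_recl weights0; under [X in _ + X]eq_bigr do rewrite weightsS.
by rewrite subrK.
Qed.

Lemma comb_weights b : \sum_i weights b i *: a i =
  a ord0 + \sum_j b j *: (a (lift ord0 j) - a ord0).
Proof.
rewrite big_ord_recl weights0; under [X in _ + X]eq_bigr do rewrite weightsS.
under [X in _ = _ + X]eq_bigr do rewrite scalerBr.
by rewrite sumrB -scaler_suml scalerBl scale1r addrA addrAC.
Qed.

Lemma hull_edges b : (forall j, 0 <= b j) -> \sum_j b j <= 1 ->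
  hull a (a ord0 + \sum_j b j *: (a (lift ord0 j) - a ord0)).
Proof.
move=> b0 b1; exists (weights b); split; last by rewrite comb_weights.
- move=> i; case: (unliftP ord0 i) => [j|] ->; first by rewrite weightsS.
  by rewrite weights0 subr_ge0.
- exact: sum_weights.
Qed.

Lemma ohull_edges b : (forall j, 0 < b j) -> \sum_j b j < 1 ->
  ohull a (a ord0 + \sum_j b j *: (a (lift ord0 j) - a ord0)).
Proof.
move=> b0 b1; exists (weights b); split; last by rewrite comb_weights.
- move=> i; case: (unliftP ord0 i) => [j|] ->; first by rewrite weightsS.
  by rewrite weights0 subr_gt0.
- exact: sum_weights.
Qed.

Lemma ohull_edgesP x : ohull a x -> exists b : 'I_m -> R,
  [/\ forall j, 0 < b j, \sum_j b j < 1 &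
      x = a ord0 + \sum_j b j *: (a (lift ord0 j) - a ord0)].
Proof.
move=> [c [c0 c1 ->]]; exists (fun j => c (lift ord0 j)).
have cw : weights (fun j => c (lift ord0 j)) =1 c.
  move=> i; case: (unliftP ord0 i) => [j|] ->; first by rewrite weightsS.
  by rewrite weights0 -c1 big_ord_recl addrK.
split => //; first by rewrite -subr_gt0 -weights0 cw.
by rewrite -comb_weights; apply: eq_bigr => i _; rewrite cw.
Qed.

Lemma hull_vertex i : hull a (a i).
Proof.
exists (fun j => (j == i)%:R); split.
- by move=> j; rewrite ler0n.
- by rewrite (bigD1 i)//= eqxx big1 ?addr0// => j /negPf->.
- rewrite (bigD1 i)//= eqxx scale1r big1 ?addr0// => j /negPf->.
  by rewrite scale0r.
Qed.

Lemma measurable_refsimplex : measurable (@refsimplex R m).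
Proof.
rewrite (_ : @refsimplex R m = [set s : tup R m | forall j, (`[0, +oo[%classic : set R) (tnth s j)]
  `&` (setT `&` (fun s : tup R m => \sum_j (tnth s j : R)) @^-1` `]-oo, 1]%classic)).
  apply: measurableI; first exact: measurable_forall_tnth.
  by apply: measurable_sum => // j; exact: measurable_tnth.
rewrite setTI; apply/seteqP; split=> s /= [].
  by move=> s0 s1; split=> [j|]; rewrite in_itv/= ?s0.
move=> s0; rewrite in_itv/= => s1; split=> // j.
by have := s0 j; rewrite in_itv/= andbT.
Qed.

Lemma refsimplex_coord_le1 (s : tup R m) j : refsimplex s -> `|tnth s j : R| <= 1.
Proof.
move=> [s0 s1]; rewrite ger0_norm//; apply: le_trans s1.
by rewrite (bigD1 j)//= lerDl sumr_ge0.
Qed.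

Lemma leb_refsimplex_fin : (@leb R m (@refsimplex R m) < +oo)%E.
Proof.
apply: (leb_bounded_fin (C := 1)); first exact: measurable_refsimplex.
by move=> s sS j; exact: refsimplex_coord_le1.
Qed.

(** What the strict inequalities leave out lies in finitely many hyperplanes: a coordinate is 0 or
    the coordinates sum to 1. *)
Lemma negligible_refsimplex_boundary :
  (@leb R m).-negligible (@refsimplex R m `\`
    [set s | (forall j, 0 < (tnth s j : R)) /\ \sum_j (tnth s j : R) < 1]).
Proof.
have meq0 (g : tup R m -> R) c : measurable_fun setT g -> measurable [set s | g s = c].
  by move=> mg; rewrite -[X in measurable X]setTI; exact: (mg measurableT [set c]).
apply: (@negligibleS _ _ _ _
    ([set s : tup R m | \sum_j (tnth s j : R) = 1] `|`
     \big[setU/set0]_(j < m) [set s : tup R m | (tnth s j : R) = 0])).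
  move=> s /= [[s0 s1] /not_andP sN].
  case: (eqVneq (\sum_j (tnth s j : R)) 1) => [|sn1]; first by left.
  right; case: sN => [/existsNP[j /negP]|/negP]; last by rewrite lt_neqAle sn1 s1.
  rewrite -leNgt => sj0; rewrite (bigD1 j)//=; left => /=.
  by apply/eqP; rewrite eq_le sj0 s0.
apply: negligibleU.
  apply/negligibleP; last exact: leb_sum_eq1.
  by apply: meq0; apply: measurable_sum => j; exact: measurable_tnth.
elim/big_rec: _ => [|j A _ An]; first exact: negligible_set0.
apply: negligibleU => //; apply/negligibleP; last exact: leb_coord0.
by apply: meq0; exact: measurable_tnth.
Qed.

End simplices.

(** * Measurability and bounds on elements and facets; facets and their normals *)

Section mesh_elements_and_facets.
Variables (R : realType) (n : nat) (O : set (pt R n)) (M : mesh O).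
Implicit Types (e : elt M) (i : 'I_n.+2).

(** Nondegeneracy makes the edge matrix invertible, so barycentric coordinates are affine functions
    of the point, and the open simplex is cut out by finitely many strict inequalities on them. *)
Lemma measurable_elt_dom e : measurable (elt_dom e).
Proof.
pose A := \matrix_(j < n.+1) (vtx e (lift ord0 j) - vtx e ord0).
have Au : A \in unitmx by rewrite unitmxE unitfE; exact: vtx_nondegenerate.
have combA (b : 'I_n.+1 -> R) :
    \sum_j b j *: (vtx e (lift ord0 j) - vtx e ord0) = (\row_j b j) *m A.
  by rewrite mulmx_sum_row; apply: eq_bigr => j _; rewrite mxE rowK.
pose b (s : tup R n.+1) j := ((pt_of_tuple s - vtx e ord0) *m invmx A) 0 j.
have mb j : measurable_fun setT (b ^~ j).
  rewrite /b; under eq_fun do rewrite mxE; apply: measurable_sum => i.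
  apply: measurable_funM => //; under eq_fun do rewrite !mxE.
  by apply: measurable_funD => //; exact: measurable_tnth.
rewrite (_ : elt_dom e =
    \big[setI/setT]_(j < n.+1) (setT `&` (b ^~ j) @^-1` `]0, +oo[%classic) `&`
    (setT `&` (fun s => \sum_j b s j) @^-1` `]-oo, 1[%classic)).
  apply: measurableI; last by apply: measurable_sum.
  by apply: bigsetI_measurable => j _; exact: mb.
rewrite setTI; apply/seteqP; split=> s.
  rewrite /elt_dom /= => /ohull_edgesP[c [c0 c1 sE]].
  have bE j : b s j = c j by rewrite /b sE addrC addKr combA mulmxK// mxE.
  split; last by under eq_bigr do rewrite bE; rewrite /= in_itv.
  by elim/big_ind: _ => //= j _; rewrite in_itv/= andbT bE; split.
rewrite /elt_dom /= in_itv/= => -[b0 b1].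
have -> : pt_of_tuple s = vtx e ord0 +
    \sum_j b s j *: (vtx e (lift ord0 j) - vtx e ord0).
  rewrite combA (_ : \row_j b s j = (pt_of_tuple s - vtx e ord0) *m invmx A).
    by rewrite mulmxKV// addrC subrK.
  by apply/rowP => j; rewrite mxE.
apply: ohull_edges => // j; move: b0; rewrite (bigD1 j)//= => -[[_ +] _].
by rewrite in_itv/= andbT.
Qed.

Lemma elt_dom_bounded e : exists C, forall s, elt_dom e s ->
  forall j, `|tnth s j : R| <= C.
Proof.
(* Summing over all vertices and all coordinates gives one bound that serves every coordinate
   [j]. *)
exists (\sum_l \sum_i `|vtx e i 0 l|) => s [c [c0 c1 sE]] j.
have -> : tnth s j = (\sum_i c i *: vtx e i) 0 j :> R by rewrite -sE mxE.
rewrite [leRHS](bigD1 j)//= summxE; apply: ler_wpDr.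
  by apply: sumr_ge0 => l _; exact: sumr_ge0.
apply: le_trans (ler_norm_sum _ _ _) _; apply: ler_sum => i _.
rewrite mxE normrM ger0_norm ?(ltW (c0 _))// ler_piMl// -c1 (bigD1 i)//=.
by rewrite lerDl sumr_ge0// => l _; exact: ltW.
Qed.

Lemma leb_elt_dom_fin e : (@leb R n.+1 (elt_dom e) < +oo)%E.
Proof.
have [C eC] := elt_dom_bounded e.
exact: leb_bounded_fin (measurable_elt_dom e) eC.
Qed.

Lemma measurable_bounded_pt_of_tuple e j :
  measurable_bounded (elt_dom e) (fun s => pt_of_tuple s 0 j).
Proof.
under eq_fun do rewrite mxE; split.
  by apply: measurable_funTS; exact: measurable_tnth.
by have [C eC] := elt_dom_bounded e; exists C => s /eC.
Qed.

Lemma facet_domT e i : facet_dom e i setT = @refsimplex R n.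
Proof. by rewrite /facet_dom preimage_setT setIT. Qed.

Lemma facet_parE e i (s : tup R n) : facet_par e i s = facet_vtx (@vtx _ _ _ M) e i ord0 +
  \sum_j (tnth s j : R) *: (facet_vtx (@vtx _ _ _ M) e i (lift ord0 j)
     - facet_vtx (@vtx _ _ _ M) e i ord0).
Proof. by congr (_ + _); apply: eq_bigr => j _; rewrite rowK. Qed.

Lemma facet_par_facet e i (s : tup R n) : @refsimplex R n s ->
  facet e i (facet_par e i s).
Proof. by move=> [s0 s1]; rewrite facet_parE; exact: hull_edges. Qed.

Lemma measurable_bounded_facet_par e i j :
  measurable_bounded (@refsimplex R n) (fun s => facet_par e i s 0 j).
Proof.
under eq_fun do rewrite facet_parE mxE summxE.
apply: measurable_boundedD; first exact: measurable_bounded_cst.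
apply: measurable_bounded_sum => l _; under eq_fun do rewrite mxE.
apply: measurable_boundedM; last exact: measurable_bounded_cst.
split; first by apply: measurable_funTS; exact: measurable_tnth.
by exists 1 => s; exact: refsimplex_coord_le1.
Qed.

Lemma measurable_bounded_Pk_facet k e i (f : pt R n -> R) : Pk_on (facet e i) k f ->
  measurable_bounded (@refsimplex R n) (f \o facet_par e i).
Proof.
move=> [g gP fg]; apply: (@eq_measurable_bounded _ _ _ _ (g \o facet_par e i)).
  by move=> s sS /=; rewrite fg//; exact: facet_par_facet.
by apply: measurable_bounded_Pk gP => j; exact: measurable_bounded_facet_par.
Qed.

(** The normal is orthogonal to differences of facet vertices, hence takes one value on all of them
    and so on their convex combinations. *)
Lemma nrm_facet e i x y : facet e i x -> facet e i y ->
  dotp (nrm e i) x = dotp (nrm e i) y.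
Proof.
suff H z : facet e i z ->
    dotp (nrm e i) z = dotp (nrm e i) (facet_vtx (@vtx _ _ _ M) e i ord0).
  by move=> /H-> /H->.
move=> [c [_ c1 ->]]; rewrite dotp_sumr -[RHS]mul1r -c1 mulr_suml.
apply: eq_bigr => j _; congr (_ * _); apply/eqP; rewrite -subr_eq0.
by rewrite dotpC [X in _ - X]dotpC -dotpBl dotpC nrm_orthogonal.
Qed.

(* The normal to a facet is constant along it and separates it from the
   opposite vertex, which lies on every other facet of the element. *)
Lemma facet_inj e : injective (@facet R n O M e).
Proof.
move=> i i' ii'; apply/eqP/negPn/negP => nii'.
case: (unliftP i' i) => [j ij|/eqP]; last by rewrite (negPf nii').
have ei : facet e i (vtx e i).
  by rewrite ii' ij; exact: (hull_vertex (facet_vtx (@vtx _ _ _ M) e i') j).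
have e0 : facet e i (facet_vtx (@vtx _ _ _ M) e i ord0) by exact: hull_vertex.
have := nrm_outward e i ord0.
by rewrite dotpC dotpBl dotpC (nrm_facet ei e0) dotpC subrr ltxx.
Qed.

(** Having one owner fixes the element, and injectivity of [facet e] fixes the index. Hence a
    skeleton function supported on such a facet contributes a single term to the double sums. *)
Lemma n_sharing1_uniq e i e' i' : n_sharing (@vtx _ _ _ M) (facet e i) = 1%N ->
  facet e' i' = facet e i -> (e', i') = (e, i).
Proof.
rewrite /n_sharing => F1 ee'.
have e'e : e' = e.
  by apply: (card_le1_eqP (eq_leq F1)); apply/mem_set/asboolP; [exists i|exists i'].
by subst e'; rewrite (facet_inj ee').
Qed.

End mesh_elements_and_facets.

Lemma is_derive_bigsum (R : numFieldType) (V W : normedModType R) (I : Type)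
    (r : seq I) (f : I -> V -> W) (x v : V) (df : I -> W) :
  (forall i, is_derive x v (f i) (df i)) ->
  is_derive x v (fun y => \sum_(i <- r) f i y) (\sum_(i <- r) df i).
Proof.
move=> fdf; elim: r => [|i r IH].
  by under eq_fun do rewrite big_nil; rewrite big_nil; exact: is_derive_cst.
by under eq_fun do rewrite big_cons; rewrite big_cons; exact: is_deriveD.
Qed.

(** * Traces and time derivatives of semi-discrete solutions *)

Section hdg_solutions.
Variables (R : realType) (n : nat) (P : mhd_problem R n) (M : mesh (Omega P)).
Implicit Types (e : elt M) (i : 'I_n.+2) (t : R).

Lemma int_facet0 e i A : int_facet e i A (fun=> 0) = 0.
Proof. by rewrite /int_facet /Rintegral integral0 mulr0. Qed.

(** The relative interior of the facet lies in the open set Omega, whereas [GammaN] lies in the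
    boundary, which misses Omega; only the relative boundary of the facet can meet [GammaN]. *)
Lemma negligible_GammaN_interior e i :
  ohull (facet_vtx (@vtx _ _ _ M) e i) `<=` Omega P ->
  (@leb R n).-negligible (facet_dom e i (GammaN P)).
Proof.
move=> FO; apply: negligibleS (negligible_refsimplex_boundary R n).
move=> s [sS sN]; split=> // -[s0 s1].
have sO : Omega P (facet_par e i s).
  by apply: FO; rewrite facet_parE; exact: ohull_edges.
have : bdry (Omega P) (facet_par e i s).
  by rewrite bdry_Omega; apply: subset_closure; right.
by case=> _; apply; move: sO; rewrite (interior_id _).1//; exact: Omega_open.
Qed.

Variables (k : nat) (Cpen : R) (S : hdg_fields M).
Hypothesis solS : hdg_solution k Cpen S.

Lemma measurable_bounded_uh t e i j : 0 <= t ->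
  measurable_bounded (@refsimplex R n) (fun s => uh S t e (facet_par e i s) 0 j).
Proof.
move=> t0; apply: (measurable_bounded_Pk_facet (f := fun x => uh S t e x 0 j)).
exact: Pk_onW (sol_uh solS t0 e j).
Qed.

Lemma measurable_bounded_uhat t e i j : 0 <= t ->
  measurable_bounded (@refsimplex R n)
    (fun s => uhat S t (facet e i) (facet_par e i s) 0 j).
Proof.
by move=> t0; have [uhP _] := sol_uhat solS t0; exact: (measurable_bounded_Pk_facet (uhP e i j)).
Qed.

(* Testing (S4) with the jump of the normal velocity on a single boundary facet
   shows that this jump vanishes there. *)
Lemma boundary_normal_trace t e i : 0 < t ->
  n_sharing (@vtx _ _ _ M) (facet e i) = 1%N ->
  facet_jac e i = 0 \/ ae_facet e i setT (fun x =>
    dotp (uh S t e x) (nrm e i) = dotp (uhat S t (facet e i) x) (nrm e i)).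
Proof.
(* A zero Jacobian is kept as an alternative: it makes every integral over the facet vanish, which
   is enough for the flux identity below. *)
move=> t0 F1; have t0' := ltW t0; case: (eqVneq (facet_jac e i) 0) => [|J0]; [by left|right].
pose g x := dotp (uh S t e x - uhat S t (facet e i) x) (nrm e i).
pose q F x := if F == facet e i then g x else 0.
(* The jump is an admissible test function because [nrm e i] is a constant vector and pressure
   traces have the same degree k as velocity traces. *)
have gP : Pk_on (facet e i) k g.
  rewrite /g /dotp; under eq_fun do under eq_bigr do rewrite mulrC.
  apply: Pk_on_sum => l; under eq_fun do rewrite !mxE addrC -mulN1r.
  apply: Pk_on_linear; first by have [+ _] := sol_uhat solS t0'; exact.
  exact/Pk_onW/(sol_uh solS t0').
have qP : Qhat M k q.
  move=> e' i'; rewrite /q; case: eqP => [->//|_].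
  exact/Pk_onW/Pk_cst.
have := sol_S4 solS t0 qP; rewrite /eqS4.
(* Only the pair [(e, i)] survives in the double sum, as no other pair yields the same facet. *)
rewrite (bigD1 e)//= [X in _ + X]big1 ?addr0 => [|e' e'e]; last first.
  apply: big1 => i' _; rewrite /q; case: eqP => [/(n_sharing1_uniq F1)[ee' _]|_].
    by rewrite ee' eqxx in e'e.
  by under [X in int_facet _ _ _ X]eq_fun do rewrite mulr0; exact: int_facet0.
rewrite (bigD1 i)//= [X in _ + X]big1 ?addr0 => [|i' i'i]; last first.
  rewrite /q; case: eqP => [/(n_sharing1_uniq F1)[ii']|_].
    by rewrite ii' eqxx in i'i.
  by under [X in int_facet _ _ _ X]eq_fun do rewrite mulr0; exact: int_facet0.
rewrite /q eqxx /int_facet facet_domT => /eqP; rewrite mulf_eq0 (negPf J0)/= => /eqP.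
have gb : measurable_bounded (@refsimplex R n) (g \o facet_par e i).
  exact: measurable_bounded_Pk_facet gP.
(* The integrand is [g] squared divided by the density: it is nonnegative, so its zero integral
   forces [g] to vanish almost everywhere. *)
move/(Rintegral_eq0_ae (@measurable_refsimplex R n)); rewrite /ae_facet facet_domT.
move=> H; apply: filterS (H _ _).
- move=> s gs0 sS; apply/eqP; rewrite -subr_eq0 -dotpBl.
  have /eqP := gs0 sS.
  by rewrite -/(g _) -mulrA mulf_eq0 invr_eq0 gt_eqF ?rho_gt0//= mulf_eq0 orbb.
- apply: integrable_measurable_bounded.
  + exact: measurable_refsimplex.
  + exact: leb_refsimplex_fin.
  + apply: measurable_boundedM => //.
    by apply: measurable_boundedM => //; exact: measurable_bounded_cst.
- move=> s _; rewrite -/(g _) -mulrA mulr_ge0 ?invr_ge0 ?(ltW (rho_gt0 P))//.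
  exact: (sqr_ge0 (g (facet_par e i s))).
Qed.

(** On a boundary facet this restricts the previous result; on an interior facet the domain itself
    is negligible. *)
Lemma GammaN_normal_trace t e i : 0 < t ->
  facet_jac e i = 0 \/ ae_facet e i (GammaN P) (fun x =>
    dotp (uh S t e x) (nrm e i) = dotp (uhat S t (facet e i) x) (nrm e i)).
Proof.
move=> t0; case: (facet_dichotomy e i) => [[_ /(boundary_normal_trace t0)[]]|[FO _]].
- by left.
- rewrite /ae_facet => H; right; apply: filterS H => s sP [sS _]; apply: sP.
  by rewrite facet_domT.
- right; apply: (negligibleS _ (negligible_GammaN_interior FO)).
  by move=> s /= /not_implyP[].
Qed.

(** The normal traces agree almost everywhere, so the integrals agree once both integrands are known
    to be measurable; [lam] is measurable because the sign of the normal velocity decides it. *)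
Lemma GammaN_flux t e i j : 0 < t -> measurable (facet_dom e i (GammaN P)) ->
  int_facet e i (GammaN P) (fun x => ((1 - lam S t e i x) * rho P
    * dotp (uhat S t (facet e i) x) (nrm e i)) * uhat S t (facet e i) x 0 j) =
  rho P * int_facet e i (GammaN P) (fun x => (1 - lam S t e i x) *
    (dotp (uh S t e x) (nrm e i) * uhat S t (facet e i) x 0 j)).
Proof.
move=> t0 mN; have t0' := ltW t0.
rewrite /int_facet; case: (GammaN_normal_trace e i t0) => [->|tr].
  by rewrite !mul0r mulr0.
rewrite mulrCA; congr (_ * _).
have mbS (f : tup R n -> R) : measurable_bounded (@refsimplex R n) f ->
    measurable_bounded (facet_dom e i (GammaN P)) f.
  exact: (measurable_boundedS (@measurable_refsimplex R n) mN (@subIsetl _ _ _)).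
have ub l := mbS _ (measurable_bounded_uh e i l t0').
have uhb l := mbS _ (measurable_bounded_uhat e i l t0').
have unb : measurable_bounded (facet_dom e i (GammaN P))
    (fun s => dotp (uh S t e (facet_par e i s)) (nrm e i)).
  apply: measurable_bounded_sum => l _.
  by apply: measurable_boundedM => //; exact: measurable_bounded_cst.
have uhnb : measurable_bounded (facet_dom e i (GammaN P))
    (fun s => dotp (uhat S t (facet e i) (facet_par e i s)) (nrm e i)).
  apply: measurable_bounded_sum => l _.
  by apply: measurable_boundedM => //; exact: measurable_bounded_cst.
have lamb : measurable_bounded (facet_dom e i (GammaN P))
    (fun s => 1 - lam S t e i (facet_par e i s)).
  apply: measurable_boundedB; first exact: measurable_bounded_cst.
  apply: measurable_bounded_if => //; try exact: measurable_bounded_cst.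
  by apply: measurable_fun_ltr => //; case: unb.
rewrite -RintegralZl//; last first.
  apply: integrable_measurable_bounded => //.
    apply: le_lt_trans (leb_refsimplex_fin R n).
    by apply: le_measure; rewrite ?inE//; [exact: measurable_refsimplex|exact: subIsetl].
  by apply: measurable_boundedM => //; exact: measurable_boundedM.
apply: ae_eq_Rintegral => //.
- apply: (proj1 (measurable_boundedM (measurable_boundedM (measurable_boundedM lamb
    (measurable_bounded_cst _ _)) uhnb) (uhb j))).
- apply: (proj1 (measurable_boundedM (measurable_bounded_cst _ _)
    (measurable_boundedM lamb (measurable_boundedM unb (uhb j))))).
- move: tr; rewrite /ae_facet; apply: filterS => s sP /sP ->.
  by rewrite [_ * rho P]mulrC -!mulrA.
Qed.

(** Separates the variables: time enters only through finitely many nodal values, and space only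
    through fixed functions. *)
Lemma uh_grid t e x : 0 <= t ->
  uh S t e x = \sum_(m : {ffun 'I_n.+1 -> 'I_k.+1})
    grid_lagrange m x *: uh S t e (grid_node R m).
Proof.
move=> t0; apply/rowP => j; rewrite summxE (grid_interpolation x (sol_uh solS t0 e j)).
by apply: eq_bigr => m _; rewrite mxE mulrC.
Qed.

Lemma is_derive_uh_grid t e (a : {ffun 'I_n.+1 -> 'I_k.+1} -> R) : 0 < t ->
  is_derive t 1 (fun s => \sum_m a m *: uh S s e (grid_node R m))
    (\sum_m a m *: dt (uh S) t e (grid_node R m)).
Proof.
move=> t0; apply: is_derive_bigsum => m; apply: is_deriveZ.
rewrite /dt derive1E; apply: derivableP.
by have [+ _] := sol_uh_diff solS; exact.
Qed.

(** The interpolation formula holds at all nonnegative times, hence throughout a neighbourhood of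
    [t], and can be differentiated there term by term. *)
Lemma dt_uh_grid t e x : 0 < t ->
  dt (uh S) t e x = \sum_(m : {ffun 'I_n.+1 -> 'I_k.+1})
    grid_lagrange m x *: dt (uh S) t e (grid_node R m).
Proof.
move=> t0; rewrite {1}/dt derive1E; apply: (@derive_val _ _ _ _ _ _ _ _).
apply: near_eq_is_derive (is_derive_uh_grid e _ t0).
by near=> s; rewrite -uh_grid//; near: s; exact: lt_le_nbhsr.
Unshelve. all: by end_near.
Qed.

Lemma integrable_grid_lagrange e (m : {ffun 'I_n.+1 -> 'I_k.+1}) :
  integrable_elt e (grid_lagrange (R := R) m).
Proof.
apply: integrable_measurable_bounded.
- exact: measurable_elt_dom.
- exact: leb_elt_dom_fin.
- apply: measurable_bounded_grid_lagrange => j.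
  exact: measurable_bounded_pt_of_tuple.
Qed.

Lemma integrable_grid e (c : {ffun 'I_n.+1 -> 'I_k.+1} -> R) :
  integrable_elt e (fun x => \sum_m grid_lagrange m x * c m).
Proof.
apply: integrable_measurable_bounded.
- exact: measurable_elt_dom.
- exact: leb_elt_dom_fin.
- apply: measurable_bounded_sum => m _; apply: measurable_boundedM.
    apply: measurable_bounded_grid_lagrange => j.
    exact: measurable_bounded_pt_of_tuple.
  exact: measurable_bounded_cst.
Qed.

Lemma int_elt_grid e (c : {ffun 'I_n.+1 -> 'I_k.+1} -> R) :
  int_elt e (fun x => \sum_m grid_lagrange m x * c m) =
  \sum_m int_elt e (grid_lagrange m) * c m.
Proof.
rewrite /int_elt Rintegral_sum.
- apply: eq_bigr => m _; rewrite RintegralZr//; first exact: measurable_elt_dom.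
  exact: integrable_grid_lagrange.
- exact: measurable_elt_dom.
- move=> m; have := integrableZr (measurable_elt_dom e) (c m) (integrable_grid_lagrange e m).
  by apply: eq_integrable => //; exact: measurable_elt_dom.
Qed.

End hdg_solutions.

(** * Balance of total momentum *)

Unset Implicit Arguments.

Theorem proposition4 (R : realType) (n : nat)
    (dim23 : (n.+1 = 2)%N \/ (n.+1 = 3)%N)
    (P : mhd_problem R n) (M : mesh (Omega P)) (k : nat) (Cpen : R)
    (sol : hdg_fields M) :
  (1 <= k)%N ->
  0 < Cpen ->
  regular_data M ->
  GammaD P = set0 ->
  hdg_solution k Cpen sol ->
  forall t : R, 0 < t ->
  is_derive t 1
    (fun s : R => \sum_(e : elt M) vint_elt e (fun x => rho P *: uh sol s e x))
    (\sum_(e : elt M) vint_elt e (fun x => rho P *: f_v P t x)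
     - \sum_(e : elt M) \sum_(i < n.+2) vint_facet e i (GammaN P) (fun x =>
         ((1 - lam sol t e i x) * rho P
          * dotp (uhat sol t (facet e i) x) (nrm e i))
           *: uhat sol t (facet e i) x)
     + \sum_(e : elt M) \sum_(i < n.+2) vint_facet e i (GammaN P) (fun x =>
         rho P *: h_v P t x)).
Proof.
move=> k1 Cpen0 reg GD0 solS t t0.
pose node := @grid_node R n k; pose l := @grid_lagrange R n k.
have ZlF e f : integrable_elt e f ->
    int_elt e (fun x => rho P * f x) = rho P * int_elt e f.
  by move=> fi; rewrite /int_elt RintegralZl//; exact: measurable_elt_dom.
(* Total momentum is a combination of nodal values with coefficients independent of time, so no
   differentiation under the integral sign is required. *)
have momentum : forall s, 0 <= s ->
    \sum_(e : elt M) vint_elt e (fun x => rho P *: uh sol s e x) =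
    \sum_(e : elt M) \sum_m (rho P * int_elt e (l m)) *: uh sol s e (node m).
  move=> s s0; apply: eq_bigr => e _; apply/rowP => j; rewrite mxE summxE.
  transitivity (int_elt e (fun x => \sum_m l m x * (rho P * uh sol s e (node m) 0 j))).
    congr int_elt; apply/funext => x; rewrite mxE (uh_grid solS e x s0) summxE mulr_sumr.
    by apply: eq_bigr => m _; rewrite mxE mulrCA.
  by rewrite int_elt_grid; apply: eq_bigr => m _; rewrite mxE mulrA [_ * rho P]mulrC.
apply: near_eq_is_derive.
  by near=> s; apply/esym/momentum; near: s; exact: lt_le_nbhsr.
apply: is_derive_eq.
  by apply: is_derive_bigsum => e; exact: (is_derive_uh_grid solS).
apply/rowP => j; rewrite summxE.
pose w e x := dt (uh sol) t e x 0 j.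
have wE e x : w e x = \sum_m l m x * dt (uh sol) t e (node m) 0 j.
  rewrite /w (dt_uh_grid solS e x t0) summxE.
  by apply: eq_bigr => m _; rewrite mxE.
have wi e : integrable_elt e (w e).
  by rewrite (funext (wE e)); exact: integrable_grid.
transitivity (rho P * \sum_(e : elt M) int_elt e (w e)).
  rewrite mulr_sumr; apply: eq_bigr => e _.
  rewrite (funext (wE e)) int_elt_grid mulr_sumr summxE.
  by apply: eq_bigr => m _; rewrite mxE mulrA.
pose ej : pt R n := delta_mx 0 j.
have PkE i : Pk k (fun _ : pt R n => ej 0 i) by exact: Pk_cst.
have := @sol_S1 _ _ _ _ _ _ _ solS t (fun _ _ => ej) t0 (fun _ i => PkE i).
(* A nonzero constant may test (S2) because the condition on [GammaD] is void. *)
have ejD : Vhat_eq M k (GammaD P) (fun=> 0) (fun _ _ => ej).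
  split=> [e i j'|e i]; first exact/Pk_onW/PkE.
  by rewrite /ae_facet GD0 /facet_dom; apply: filterE => s [].
have := @sol_S2 _ _ _ _ _ _ _ solS t (fun _ _ => ej) t0 ejD.
rewrite /eqS1 /eqS2.
(* Element and skeleton test fields both equal [ej], so this sum is the same in (S1) and (S2). *)
set flux := (X in X - _ + _ = 0 -> _).
move=> S2; rewrite -/flux [X in _ - X = 0 -> _]big1 => [|e _]; last first.
  apply: big1 => i _; under [X in int_facet _ _ _ X]eq_fun do rewrite sgrad_cst ddot0r mulr0.
  exact: int_facet0.
(* Every volume term containing a gradient of the test field drops out, leaving the time derivative
   and the force. *)
under [X in X + _ - _ = 0 -> _]eq_bigr => e _.
  under [X in int_elt _ X]eq_fun => x.
    rewrite grad_cst sgrad_cst !ddot0r !mulr0 !subr0 !addr0 !dotp_delta.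
    over.
  rewrite {1}/int_elt RintegralB; [|exact: measurable_elt_dom|exact: wi|exact: reg_f_v].
  over.
rewrite sumrB subr0 => S1.
move: S2; rewrite -/flux.
under eq_bigr do under eq_bigr do under [X in int_facet _ _ _ X]eq_fun do
  rewrite ddot_otimes dotp_delta.
under [X in _ + X = 0 -> _]eq_bigr do under eq_bigr do
  under [X in int_facet _ _ _ X]eq_fun do rewrite dotp_delta.
set N := (X in _ - X + _ = 0 -> _); set H := (X in _ - _ + X = 0 -> _) => S2.
have -> : \sum_(e : elt M) int_elt e (w e) =
    \sum_(e : elt M) int_elt e (fun x => f_v P t x 0 j) - N + H.
  (* (S2) expresses the numerical flux through Neumann terms only, and (S1) then eliminates it. *)
  have fluxE : flux = N - H by apply/eqP; rewrite -subr_eq0 opprB addrA addrAC S2.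
  apply/eqP; rewrite -subr_eq0 -[eqbRHS]S1 fluxE; apply/eqP.
  by rewrite !opprD opprK !addrA.
rewrite mulrDr mulrBr !mxE !summxE; congr (_ - _ + _).
- rewrite mulr_sumr; apply: eq_bigr => e _; rewrite mxE.
  under [X in _ = int_elt _ X]eq_fun do rewrite mxE.
  by rewrite ZlF//; exact: reg_f_v.
- rewrite mulr_sumr; apply: eq_bigr => e _; rewrite summxE mulr_sumr.
  apply: eq_bigr => i _; rewrite mxE.
  under [X in _ = int_facet _ _ _ X]eq_fun do rewrite mxE.
  (* Here the normal component of [uh] is exchanged for that of [uhat]. *)
  by rewrite (GammaN_flux solS)//; exact: reg_GammaN.
- rewrite mulr_sumr; apply: eq_bigr => e _; rewrite summxE mulr_sumr.
  apply: eq_bigr => i _; rewrite mxE.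
  under [X in _ = int_facet _ _ _ X]eq_fun do rewrite mxE.
  rewrite /int_facet RintegralZl; [by rewrite mulrCA|exact: reg_GammaN|exact: reg_h_v].
Unshelve. all: by end_near.
Qed.
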